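(* Let $V$ be a DVR with quotient field $K$ and perfect residue field, and let $W$ be a DVR with quotient field $K(X)$ which extends $V$ (that is, $W\cap K=V$) and is residually algebraic over $V$. Denote by $k_w$ and $k_v$ the residue fields of $W$ and of $V$. Read $X$ inside the completion $\widehat{K(X)}$ of $K(X)$ with respect to the valuation $w$ associated with $W$, which contains a canonical copy of $\widehat K$ (the closure of $K$). Then $$X\text{ is algebraic over }\widehat K\iff[k_w:k_v]<\infty.$$ In particular, if $K$ is complete, then $[k_w:k_v]=\infty$ for every such $W$, and hence $\alpha\notin\overline{\widehat K}$ for every $\alpha\in\mathbb{K}$ transcendental over $K$ with $W=V_{\alpha}$.
   Context: A DVR is a discrete valuation domain of rank one (value group isomorphic to $\mathbb{Z}$). $V$ is a DVR with quotient field $K$ and associated valuation $v$; $X$ is an indeterminate over $K$. $W$ is residually algebraic over $V$ if its residue field $k_w$ is algebraic over $k_v$. $\widehat K$ is the $v$-adic completion of $K$; $K$ is complete if $K=\widehat K$. $\overline{\widehat K}$ is an algebraic closure of $\widehat K$, and $v$ also denotes its unique extension to $\overline{\widehat K}$; $\mathbb{K}$ is the completion of $\overline{\widehat K}$ with respect to $v$, with the extended valuation again denoted $v$. For $\alpha\in\mathbb{K}$ transcendental over $K$, put $V_\alpha=\{\phi\in K(X)\mid v(\phi(\alpha))\ge 0\}$, a valuation domain of $K(X)$. *)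

(* Defs.v *)
From HB Require Import structures.
From mathcomp Require Import all_boot all_order all_algebra all_field.
From mathcomp Require Import generic_quotient ring_quotient.
From mathcomp Require Import constructive_ereal.
From mathcomp Require boolp.
Set Implicit Arguments.
Unset Strict Implicit.
Unset Printing Implicit Defensive.
Import Order.TTheory GRing.Theory Num.Theory.
Local Open Scope ring_scope.
Local Open Scope quotient_scope.

(* Krull valuations in additive notation, with [v 0 = +oo]. The codomain      *)
(* [\bar G] also contains [-oo], which the second axiom excludes. [G] need    *)
(* not be the value group; below it is [int] or [rat].                        *)
Record valuation (F : fieldType) (G : realDomainType) := Valuation {
  val_fun :> F -> \bar G;
  val0 : val_fun 0 = +oo%E;
  val_fin : forall x, x != 0 -> exists g : G, val_fun x = g%:E;
  valM : forall x y, val_fun (x * y) = (val_fun x + val_fun y)%E;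
  valD : forall x y, (mine (val_fun x) (val_fun y) <= val_fun (x + y)%R)%E
}.

(* Surjectivity onto [int] makes [v] the normalized valuation of its          *)
(* valuation ring, so that such [v] and discrete valuation rings of rank one  *)
(* with quotient field [F] determine each other.                              *)
Definition discrete (F : fieldType) (v : valuation F int) : Prop :=
  forall n : int, exists x : F, v x = n%:E.

Section ValuationTheory.
Variables (F : fieldType) (G : realDomainType) (v : valuation F G).
Local Open Scope ereal_scope.

Lemma val1 : v 1%R = 0.
Proof.
have [g vg] := val_fin v (oner_neq0 F).
have := valM v 1%R 1%R; rewrite mulr1 vg => /(congr1 (@fine G)) /= /esym/eqP.
by rewrite -subr_eq0 addrK => /eqP ->.
Qed.

Lemma valN1 : v (- 1)%R = 0.
Proof.
have N1 : (- 1 : F)%R != 0%R by rewrite oppr_eq0 oner_neq0.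
have [g vg] := val_fin v N1.
have := valM v (- 1)%R (- 1)%R; rewrite mulrNN mulr1 val1 vg.
move=> /(congr1 (@fine G)) /= /esym/eqP.
by rewrite -mulr2n mulrn_eq0 /= => /eqP ->.
Qed.

Lemma valN x : v (- x)%R = v x.
Proof. by rewrite -mulN1r valM valN1 add0e. Qed.

Lemma valV x : x != 0%R -> v x + v x^-1%R = 0.
Proof. by move=> x0; rewrite -valM mulfV// val1. Qed.

End ValuationTheory.

Section ResidueField.
Variables (F : fieldType) (G : realDomainType) (v : valuation F G).

Definition valring : {pred F} := fun x => (0%E <= v x)%E.

Lemma valringE x : (x \in valring) = (0%E <= v x)%E.
Proof. by []. Qed.

Lemma valring_subring : subring_closed valring.
Proof.
split=> [|x y|x y]; rewrite !valringE ?val1// => vx vy.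
- by apply: le_trans (valD v x (- y)); rewrite le_min vx valN vy.
- by rewrite valM adde_ge0.
Qed.
HB.instance Definition _ := GRing.isSubringClosed.Build F valring valring_subring.

Definition valring_type : Type := {x : F | x \in valring}.
HB.instance Definition _ := SubChoice.on valring_type.
HB.instance Definition _ := [SubChoice_isSubComNzRing of valring_type by <:].

Definition maxideal : {pred valring_type} := fun x => (0%E < v (val x))%E.

Lemma maxidealE x : (x \in maxideal) = (0%E < v (val x))%E.
Proof. by []. Qed.

Lemma maxideal_closed : idealr_closed maxideal.
Proof.
split=> [||a x y]; rewrite !maxidealE.
- by rewrite raddf0 val0 ltry.
- by rewrite rmorph1 val1 ltxx.
move=> mx my; rewrite rmorphD rmorphM.
apply: lt_le_trans (valD v _ _); rewrite lt_min my andbT valM.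
have va : (0%E <= v (val a))%E := valP a.
by apply: lt_le_trans mx _; rewrite leeDr.
Qed.
HB.instance Definition _ := isIdealr.Build valring_type maxideal maxideal_closed.

Definition resfield : Type := {ideal_quot maxideal}.
HB.instance Definition _ := GRing.ComNzRing.on resfield.
HB.instance Definition _ := Quotient.on resfield.

(* The residue of [x]; it is [0] when [x] is not in the valuation ring. *)
Definition residue (x : F) : resfield :=
  \pi_resfield (insubd (0 : valring_type) x).

Lemma residue_val (x : valring_type) : residue (val x) = \pi_resfield x.
Proof. by rewrite /residue valKd. Qed.

Lemma residue_repr (x : resfield) : residue (val (repr x)) = x.
Proof. by rewrite residue_val reprK. Qed.

Lemma residue_eq0 (x : F) : x \in valring -> (residue x == 0) = (0%E < v x)%E.
Proof.
move=> vx; rewrite /residue -[0 : resfield](rmorph0 \pi_resfield).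
by rewrite -(Quotient.idealrBE maxideal) subr0 maxidealE insubdK.
Qed.

Lemma residueD : {in valring &, {morph residue : x y / x + y}}.
Proof.
move=> x y vx vy; rewrite /residue -rmorphD; congr (\pi_resfield _).
by apply: val_inj; rewrite rmorphD /= !insubdK ?rpredD.
Qed.

Lemma residueM : {in valring &, {morph residue : x y / x * y}}.
Proof.
move=> x y vx vy; rewrite /residue -rmorphM; congr (\pi_resfield _).
by apply: val_inj; rewrite rmorphM /= !insubdK ?rpredM.
Qed.

Lemma residueB : {in valring &, {morph residue : x y / x - y}}.
Proof.
move=> x y vx vy; rewrite /residue -rmorphB; congr (\pi_resfield _).
by apply: val_inj; rewrite rmorphB /= !insubdK ?rpredB.
Qed.

Lemma residue1 : residue 1 = 1.
Proof.
by rewrite [1 : F](_ : _ = val (1 : valring_type)) // residue_val rmorph1.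
Qed.

Definition resinv (x : resfield) : resfield := residue (val (repr x))^-1.

Lemma resinv_mulVf x : x != 0 -> resinv x * x = 1.
Proof.
set y := val (repr x); have vy : y \in valring := valP _.
rewrite -{1}[x]residue_repr residue_eq0 // -/y -leNgt => vy_le0.
have vy0 : v y = 0%E by apply/eqP; rewrite eq_le vy_le0.
have y0 : y != 0 by apply/eqP => y0; move: vy0; rewrite y0 val0.
have vyV : y^-1 \in valring.
  by have := valV v y0; rewrite vy0 add0e valringE => ->.
by rewrite -{2}[x]residue_repr -residueM // mulVf ?residue1.
Qed.

Lemma resinv0 : resinv 0 = 0.
Proof.
rewrite /resinv; set y := val _.
have vy : (0%E < v y)%E.
  by rewrite -residue_eq0 ?residue_repr//; exact: valP.
have [->|y0] := eqVneq y 0.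
  rewrite invr0 [0 : F](_ : _ = val (0 : valring_type)) //.
  by rewrite residue_val rmorph0.
have := valV v y0; rewrite /residue.
have [|vyV] := boolP (y^-1 \in valring); last by rewrite /insubd insubN // rmorph0.
rewrite valringE => vyV /eqP; rewrite gt_eqF //.
by apply: lt_le_trans vy _; rewrite leeDl.
Qed.

HB.instance Definition _ :=
  GRing.ComNzRing_isField.Build resfield resinv_mulVf resinv0.

End ResidueField.

(* The map of residue fields induced by [f : F -> E]. It is meaningful when   *)
(* [f] maps the valuation ring and maximal ideal of [v] into those of [w].    *)
Definition resmap (F E : fieldType) (f : F -> E) (G H : realDomainType)
    (v : valuation F G) (w : valuation E H) (x : resfield v) : resfield w :=
  residue w (f (val (repr x))).
Arguments resmap {F E} f {G H} v w x.

Section Resmap.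
Variables (F E : fieldType) (f : {rmorphism F -> E}) (G H : realDomainType).
Variables (v : valuation F G) (w : valuation E H).
Hypothesis fvw : forall x, (f x \in valring w) = (x \in valring v).

Let fmax x : (0%E < v x)%E -> (0%E < w (f x))%E.
Proof.
move=> vx; have wx : f x \in valring w by rewrite fvw valringE ltW.
rewrite lt_neqAle -valringE wx andbT; apply/eqP => wx0.
have [x0|x0] := eqVneq x 0; first by rewrite x0 rmorph0 val0 in wx0.
have : x^-1 \in valring v.
  have fx0 : f x != 0 by rewrite fmorph_eq0.
  by have := valV w fx0; rewrite -fvw fmorphV -wx0 add0e valringE => ->.
rewrite valringE => vxV; have /eqP := valV v x0.
by rewrite gt_eqF //; apply: lt_le_trans vx _; rewrite leeDl.
Qed.

Lemma resmap_residue x :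
  x \in valring v -> resmap f v w (residue v x) = residue w (f x).
Proof.
move=> vx; rewrite /resmap; set y := val _.
have vy : y \in valring v := valP _.
have /eqP ry : residue v y == residue v x by rewrite residue_repr.
have : residue v (y - x) == 0 by rewrite residueB // ry subrr.
rewrite residue_eq0 ?rpredB // => /fmax.
by rewrite -residue_eq0 ?fvw ?rpredB // rmorphB residueB ?fvw // subr_eq0 => /eqP.
Qed.

Lemma resmap_zmod_morphism : zmod_morphism (resmap f v w).
Proof.
move=> x y; rewrite -[x]residue_repr -[y]residue_repr.
set a := val _; set b := val _.
have va : a \in valring v := valP _; have vb : b \in valring v := valP _.
by rewrite -residueB // !resmap_residue ?rpredB // rmorphB residueB ?fvw.
Qed.

Lemma resmap_monoid_morphism : monoid_morphism (resmap f v w).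
Proof.
split=> [|x y].
  by rewrite -[1]residue1 resmap_residue ?rpred1 // rmorph1 residue1.
rewrite -[x]residue_repr -[y]residue_repr.
set a := val _; set b := val _.
have va : a \in valring v := valP _; have vb : b \in valring v := valP _.
by rewrite -residueM // !resmap_residue ?rpredM // rmorphM residueM ?fvw.
Qed.

End Resmap.

Definition perfect_field (k : fieldType) : Prop :=
  forall p : {poly k}, irreducible_poly p -> separable_poly p.

Definition finite_degree (k l : fieldType) (f : k -> l) : Prop :=
  exists (n : nat) (b : 'I_n -> l), forall y : l,
    exists c : 'I_n -> k, y = \sum_(i < n) f (c i) * b i.

Definition algebraic_ext (k l : fieldType) (f : k -> l) : Prop :=
  forall y : l, algebraicOver f y.

Definition algebraic_closure (k l : fieldType) (f : k -> l) : Prop :=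
  algebraic_ext f /\ GRing.closed_field_axiom l.

Definition algebraic_over_subset (l : fieldType) (A : l -> Prop) (x : l) : Prop :=
  exists p : {poly l}, [/\ p != 0, forall i, A p`_i & root p x].

(* Sequences suffice for completeness, as [int] and [rat] have countable      *)
(* cofinality.                                                                *)
Section Completion.
Variables (F : fieldType) (G : realDomainType).

Definition val_cvg (v : valuation F G) (s : nat -> F) (l : F) : Prop :=
  forall g : G, exists N, forall n, (N <= n)%N -> (g%:E < v (s n - l)%R)%E.

Definition val_cauchy (v : valuation F G) (s : nat -> F) : Prop :=
  forall g : G, exists N, forall m n, (N <= m)%N -> (N <= n)%N ->
    (g%:E < v (s m - s n)%R)%E.

Definition val_complete (v : valuation F G) : Prop :=
  forall s, val_cauchy v s -> exists l, val_cvg v s l.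

Definition val_closure (v : valuation F G) (A : F -> Prop) (x : F) : Prop :=
  forall g : G, exists2 a, A a & (g%:E < v (x - a)%R)%E.

End Completion.

Definition is_completion (F E : fieldType) (G : realDomainType)
    (v : valuation F G) (f : F -> E) (u : valuation E G) : Prop :=
  [/\ forall x, u (f x) = v x,
      forall y, val_closure u (fun z => exists x, z = f x) y
    & val_complete u].

Lemma val_completeP (F E : fieldType) (G : archiRealDomainType)
    (v : valuation F G) (f : {rmorphism F -> E}) (u : valuation E G) :
  is_completion v f u -> val_complete v <-> forall y, exists x, y = f x.
Proof.
move=> [uf dense uC]; have vE x y : v (x - y) = u (f x - f y).
  by rewrite -rmorphB uf.
have uC3 (g : G) (x y z : E) :
    (g%:E < u (y - x)%R -> g%:E < u (y - z)%R -> g%:E < u (x - z)%R)%E.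
  rewrite -[u (y - x)]valN opprB => xy yz.
  have -> : x - z = (x - y) + (y - z) by rewrite addrA subrK.
  by apply: lt_le_trans (valD _ _ _); rewrite lt_min xy.
split=> [vC y|fS s sC]; last first.
  have [|l sl] := uC (f \o s).
    by move=> g; have [N sN] := sC g; exists N => m n Nm Nn; rewrite -vE sN.
  have [x lE] := fS l; exists x => g; have [N sN] := sl g; exists N => n Nn.
  by rewrite vE -lE sN.
have /boolp.choice[s sP] (n : nat) :
    exists x, ((n%:R : G)%:E < u (y - f x)%R)%E.
  by have [_ [x ->]] := dense y n%:R; exists x.
have fsy (g : G) : exists N, forall n, (N <= n)%N -> (g%:E < u (y - f (s n))%R)%E.
  exists (Num.bound `|g|) => n gn; apply: le_lt_trans (sP n); rewrite lee_fin.
  apply: le_trans (ler_norm g) (ltW _).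
  apply: lt_le_trans (archi_boundP (normr_ge0 g)) _.
  by rewrite ler_nat.
have [|l sl] := vC s.
  move=> g; have [N sN] := fsy g; exists N => m n Nm Nn.
  by rewrite vE; apply: (@uC3 _ _ y); exact: sN.
exists l; apply/eqP; rewrite -subr_eq0; apply/negP => /negP yl.
have [g ug] := val_fin u yl.
have [N1 sN1] := fsy g; have [N2 sN2] := sl g.
have: (g%:E < u (y - f l)%R)%E.
  apply: (@uC3 _ _ (f (s (maxn N1 N2)))); last by rewrite -vE sN2 ?leq_maxr.
  by rewrite -valN opprB sN1 ?leq_maxl.
by rewrite ug ltxx.
Qed.

Section RationalFunctions.
Variable K : fieldType.

Definition ratC : K -> {fraction {poly K}} := @FracField.tofrac _ \o polyC.
HB.instance Definition _ := GRing.RMorphism.on ratC.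

Definition ratX : {fraction {poly K}} := FracField.tofrac 'X.

Variables (E : fieldType) (f : {rmorphism K -> E}).

(* [repr phi] is some fraction representing [phi]; for [a] transcendental     *)
(* over [K] the value does not depend on it, see [ratfun_evalE].              *)
Definition ratfun_eval (a : E) (phi : {fraction {poly K}}) : E :=
  (map_poly f \n_(repr phi)).[a] / (map_poly f \d_(repr phi)).[a].

Lemma ratfun_evalE (a : E) (p q : {poly K}) : ~ algebraicOver f a -> q != 0 ->
  ratfun_eval a (FracField.tofrac p / FracField.tofrac q)
    = (map_poly f p).[a] / (map_poly f q).[a].
Proof.
move=> ntr q0; rewrite /ratfun_eval; set phi := (FracField.tofrac p / _); set r := repr phi.
have nz (s : {poly K}) : s != 0 -> (map_poly f s).[a] != 0.
  by move=> s0; apply/negP => sa; apply: ntr; exists s.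
have phiE : phi * FracField.tofrac \d_r = FracField.tofrac \n_r.
  rewrite -[phi]reprK -/r; unlock FracField.tofrac.
  rewrite -[LHS]FracField.pi_mul; apply/eqmodP.
  rewrite /= FracField.equivfE /FracField.mulf !numden_Ratio ?oner_neq0 //.
  - by rewrite !mulr1 mulrC.
  - by rewrite mulr1 denom_ratioP.
  - by rewrite mulr1 denom_ratioP.
have q0F : FracField.tofrac q != 0 by rewrite tofrac_eq0.
apply/eqP; rewrite eqr_div ?nz ?denom_ratioP // -!hornerM -!rmorphM.
suff -> : \n_r * q = p * \d_r by [].
apply/eqP; rewrite -tofrac_eq !tofracM -phiE /phi.
by rewrite mulrAC divfK.
Qed.

Definition val_at (G : realDomainType) (u : valuation E G) (a : E) :
  {pred {fraction {poly K}}} := fun phi => (0%E <= u (ratfun_eval a phi))%E.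

End RationalFunctions.

(* Main.v *)
Require Import Defs.
From HB Require Import structures.
From mathcomp Require Import all_boot all_order all_algebra all_field.
From mathcomp Require Import constructive_ereal.
From mathcomp Require boolp.
Set Implicit Arguments.
Unset Strict Implicit.
Unset Printing Implicit Defensive.
Import Order.TTheory GRing.Theory Num.Theory.
Import Defs.
Local Open Scope ring_scope.

(** Write [k_v], [k_w] for the residue fields, [L] for the completion of [K(X)]
and [Khat] for the closure of [K] in [L].

If [k_w] is finite over [k_v], then lifts of a finite spanning family,
multiplied by the powers [1, p, ..., p ^ (e - 1)] of a uniformizer [p] of [w],
approximate every [w]-integral element modulo a uniformizer [t] of [v], where
[w t = e]; the coefficients are [v]-integral ([residue_approx]). Dividing the
error by [t] and iterating gives [t]-adic expansions, whose coefficients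
converge in a complete field. So the family spans [L] over [Khat], and, when
[K] itself is complete, already spans [K(X)] over [K]
([approximated_finite_degree]). A finite extension is algebraic
([finite_degree_algebraic]), hence [X] is algebraic over [Khat] in the first
case; the second case is absurd, since [X] is transcendental over [K]. Working
directly in [K(X)] there yields infinite residue degree for complete [K]
without constructing a completion of [K(X)].

Conversely, let [X] be a root of a polynomial of degree [d] over [Khat]. Any
[d + 1] elements of [K(X)] are linearly dependent over [Khat]
([ratfun_dependent]). If they are [w]-integral, scale the relation so that its
coefficients are integral and one of them is [1], then approximate the
coefficients by elements of [K] and reduce: any [d + 1] elements of [k_w] are
linearly dependent over [k_v], so the residue degree is at most [d]
([algebraic_finite_residue]).

Finally, if [K] is complete then it is all of its completion, so its algebraic
closure is algebraic over [K] and contains no transcendental [alpha]. *)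

(** * Valuations with integer values *)

Section IntegerValuation.
Variables (F : fieldType) (v : valuation F int).

Lemma val_gtE (n : int) x : (n%:E < v x)%E = ((n + 1)%R%:E <= v x)%E.
Proof. by case: (v x) => [r||]; rewrite ?lte_fin ?lee_fin ?lezD1 ?ltry ?leey. Qed.

Lemma val_geD (g : \bar int) x y :
  (g <= v x)%E -> (g <= v y)%E -> (g <= v (x + y)%R)%E.
Proof. by move=> vx vy; apply: le_trans (valD v x y); rewrite le_min vx. Qed.

Lemma val_geB (g : \bar int) x y :
  (g <= v x)%E -> (g <= v y)%E -> (g <= v (x - y)%R)%E.
Proof. by move=> vx vy; rewrite val_geD ?valN. Qed.

Lemma val_ge_sum (I : finType) (g : \bar int) (s : I -> F) :
  (forall i, (g <= v (s i))%E) -> (g <= v (\sum_i s i)%R)%E.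
Proof.
by move=> vs; elim/big_ind: _ => [|x y|i _] //; [rewrite val0 leey | exact: val_geD].
Qed.

Lemma val_geM (m n : int) x y :
  (m%:E <= v x)%E -> (n%:E <= v y)%E -> ((m + n)%R%:E <= v (x * y)%R)%E.
Proof. by move=> vx vy; rewrite valM EFinD leeD. Qed.

Lemma valV_fin (m : int) x : x != 0 -> v x = m%:E -> v x^-1 = (- m)%:E.
Proof.
move=> x0 vx; have [g vV] := val_fin v (invr_neq0 x0).
have := valV v x0; rewrite vx vV -EFinD => -[] /eqP.
by rewrite addr_eq0 => /eqP ->; rewrite opprK.
Qed.

Lemma valXz (m n : int) x : x != 0 -> v x = m%:E -> v (x ^ n) = (m * n)%:E.
Proof.
move=> x0 vx; have pos (k : nat) : v (x ^ k) = (m * k)%:E.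
  elim: k => [|k IHk]; first by rewrite expr0z val1 mulr0.
  by rewrite -addn1 PoszD expfzDr// expr1z valM IHk vx -EFinD mulrDr mulr1.
case: n => k; first exact: pos.
by rewrite NegzE -invr_expz (valV_fin _ (pos _)) ?mulrN // expfz_neq0.
Qed.

Lemma val_gt0 x : x != 0 -> (0 < v x)%E = (x^-1 \notin valring v).
Proof.
move=> x0; have [m vx] := val_fin v x0.
by rewrite valringE (valV_fin x0 vx) vx lte_fin lee_fin oppr_ge0 ltNge.
Qed.

Lemma val_ge_div (m n : int) x y :
  x != 0 -> v x = m%:E -> (n%:E <= v (y / x)%R)%E = ((n + m)%R%:E <= v y)%E.
Proof.
move=> x0 vx; rewrite valM (valV_fin x0 vx).
by case: (v y) => [r||] //=; rewrite ?leey // !lee_fin lerBrDr.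
Qed.

Lemma val_lower x : exists n : int, (n%:E <= v x)%E.
Proof.
have [->|x0] := eqVneq x 0; first by exists 0; rewrite val0 leey.
by have [n ->] := val_fin v x0; exists n.
Qed.

Lemma val_unbounded_eq0 x : (forall n : nat, (n%:Z%:E <= v x)%E) -> x = 0.
Proof.
move=> vx; apply/eqP/negP => /negP x0; have [m vm] := val_fin v x0.
have := vx (absz (m + 1)%R); rewrite vm lee_fin leNgt => /negP; apply.
by rewrite -lezD1 abszE ler_norm.
Qed.

Lemma val_ge_approx (g : \bar int) x y :
  (g <= v (x - y)%R)%E -> (g <= v x)%E -> (g <= v y)%E.
Proof. by move=> vxy vx; rewrite -[y](subKr x) val_geB. Qed.

Lemma val_fin_approx (m : int) x y :
  v x = m%:E -> (m%:E < v (x - y)%R)%E -> v y = m%:E.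
Proof.
move=> vx vxy; apply/eqP; rewrite eq_le andbC (val_ge_approx (ltW vxy)) ?vx //=.
rewrite leNgt; apply/negP => vy.
have : (m%:E < v (x - y + y)%R)%E.
  by apply: lt_le_trans (valD v _ _); rewrite lt_min vxy.
by rewrite subrK vx ltxx.
Qed.

End IntegerValuation.

Section Pullback.
Variables (F E : fieldType) (f : {rmorphism F -> E}).
Variables (G : realDomainType) (w : valuation E G).

Lemma pull0 : w (f 0) = +oo%E. Proof. by rewrite rmorph0 val0. Qed.
Lemma pull_fin x : x != 0 -> exists g : G, w (f x) = g%:E.
Proof. by move=> x0; apply: val_fin; rewrite fmorph_eq0. Qed.
Lemma pullM x y : w (f (x * y)) = (w (f x) + w (f y))%E.
Proof. by rewrite rmorphM valM. Qed.
Lemma pullD x y : (mine (w (f x)) (w (f y)) <= w (f (x + y)%R))%E.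
Proof. by rewrite rmorphD valD. Qed.

Definition val_pull : valuation F G := Valuation pull0 pull_fin pullM pullD.

End Pullback.

(** * Extensions of discrete valuations *)

Section Extension.
Variables (F E : fieldType) (f : {rmorphism F -> E}).
Variables (v : valuation F int) (w : valuation E int).
Hypothesis discrete_v : discrete v.
Hypothesis fvw : forall x, (f x \in valring w) = (x \in valring v).

Lemma extension_gt0 (x : F) : (0 < w (f x))%E = (0 < v x)%E.
Proof.
have [->|x0] := eqVneq x 0; first by rewrite rmorph0 !val0.
by rewrite !val_gt0 ?fmorph_eq0 // -fmorphV fvw.
Qed.

(** [w \o f] is [v] multiplied by the ramification index. *)
Lemma ramification : exists2 e : int, 0 < e &
  forall x (n : int), (n%:E <= v x)%E = ((n * e)%R%:E <= w (f x))%E.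
Proof.
have [t vt] := discrete_v 1.
have t0 : t != 0 by apply/eqP => t0; move: vt; rewrite t0 val0.
have ft0 : f t != 0 by rewrite fmorph_eq0.
have : (0 < w (f t))%E by rewrite extension_gt0 vt.
have [e we] := val_fin w ft0; rewrite we lte_fin.
move=> e_gt0; exists e => // x n.
have vtn := valXz n t0 vt; have wtn := valXz n ft0 we.
have -> : (n%:E <= v x)%E = (x / t ^ n \in valring v).
  by rewrite valringE (val_ge_div _ _ _ vtn) ?expfz_neq0 // add0r mul1r.
rewrite -fvw valringE fmorph_div /= rmorphXz ?unitfE //.
rewrite (val_ge_div _ _ _ wtn) ?expfz_neq0 //.
by rewrite add0r mulrC.
Qed.

Lemma val_complete_pull : val_complete v -> val_complete (val_pull f w).
Proof.
have [e e_gt0 ramE] := ramification.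
move=> vC s sC; have [|l sl] := vC s.
  move=> g; have [N sN] := sC ((g + 1) * e); exists N => m n Nm Nn.
  by rewrite val_gtE ramE ltW // sN.
exists l => g; have [N sN] := sl `|g|; exists N => n Nn.
apply: lt_le_trans (_ : ((`|g| + 1) * e)%R%:E <= _)%E.
  rewrite lte_fin; apply: le_lt_trans (ler_norm g) _.
  by rewrite mulrDl mul1r ltr_pwDr // ler_peMr // -gtz0_ge1.
by rewrite /= -ramE -val_gtE sN.
Qed.

End Extension.

(** * Finite extensions of fields *)

Section FiniteExtension.
Variables (F E : fieldType) (f : {rmorphism F -> E}).

(** Multiplication by [x] acts on a spanning family by a matrix over [F], of
    which [x] is then an eigenvalue: its characteristic polynomial kills [x]. *)
Lemma finite_degree_algebraic : finite_degree f -> algebraic_ext f.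
Proof.
move=> [n [b bP]] x; have /boolp.choice[c cP] i := bP (x * b i).
pose M : 'M[F]_n := \matrix_(j, i) c i j; pose r : 'rV[E]_n := \row_i b i.
exists (char_poly M); first exact: monic_neq0 (char_poly_monic M).
rewrite map_char_poly -eigenvalue_root_char; apply/eigenvalueP; exists r.
  by apply/rowP => i; rewrite !mxE cP; apply: eq_bigr => j _; rewrite !mxE mulrC.
apply/eqP => r0; have [d /eqP] := bP 1; rewrite big1 ?oner_eq0 // => i _.
by have /rowP/(_ i) := r0; rewrite !mxE => ->; rewrite mulr0.
Qed.

Definition dependent n (b : 'I_n -> E) : Prop :=
  exists2 c : 'I_n -> F, exists i, c i != 0 & \sum_i f (c i) * b i = 0.

(** A longest independent family spans: adding any element to it creates a
    relation in which that element has a nonzero coefficient. *)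
Lemma dependent_finite_degree n :
  (forall b : 'I_n -> E, dependent b) -> finite_degree f.
Proof.
elim: n => [|n IHn] dep; first by have [c [[]]] := dep (fun=> 0).
have [|/boolp.existsNP[b indep]] := boolp.pselect (forall b : 'I_n -> E, dependent b).
  exact: IHn.
exists n, b => y; have [c [i ci]] := dep (fun i => oapp b y (unlift ord0 i)).
rewrite big_ord_recl unlift_none /=.
under eq_bigr do rewrite liftK /=.
move=> sum0; have [c0|c0] := eqVneq (c ord0) 0.
  case: indep; exists (fun j => c (lift ord0 j)); last first.
    by move: sum0; rewrite c0 rmorph0 mul0r add0r.
  case: (unliftP ord0 i) ci => [j ->|->]; first by exists j.
  by rewrite c0 eqxx.
exists (fun j => - (c (lift ord0 j) / c ord0)).
have fc0 : f (c ord0) != 0 by rewrite fmorph_eq0.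
move/eqP: sum0; rewrite addr_eq0 => /eqP sum0.
apply: (mulfI fc0); rewrite sum0 mulr_sumr -sumrN; apply: eq_bigr => j _.
by rewrite rmorphN fmorph_div mulNr mulrN mulrA mulrCA mulfV ?mulr1.
Qed.

End FiniteExtension.

(** * Successive approximation over a complete field *)

Section SuccessiveApproximation.
Variables (F E : fieldType) (f : {rmorphism F -> E}) (w : valuation E int).
Variables (t : F) (n : nat) (z : 'I_n -> E).
Hypotheses (complete_F : val_complete (val_pull f w)).
Hypotheses (t_neq0 : t != 0) (t_pos : (0 < w (f t))%E).
Hypothesis z_int : forall i, (0 <= w (z i))%E.
Hypothesis z_approx : forall y, (0 <= w y)%E ->
  exists c : 'I_n -> F, (forall i, (0 <= w (f (c i)))%E) /\
    (w (f t) <= w (y - \sum_i f (c i) * z i)%R)%E.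

Lemma val_geXn k : (k%:Z%:E <= w (f t ^+ k)%R)%E.
Proof.
elim: k => [|k IHk]; first by rewrite val1.
by rewrite exprSr intS addrC val_geM.
Qed.

(** The [t]-adic expansion: [rem k] is the error after [k] approximations,
    divided by [t ^ k], and [s i k] is the [k]-th partial sum of the
    coefficient of [z i]. *)
Lemma span_integral y : (0 <= w y)%E ->
  exists c : 'I_n -> F, y = \sum_i f (c i) * z i.
Proof.
have ft0 : f t != 0 by rewrite fmorph_eq0.
have /boolp.choice[C CP] (x : E) : exists c : 'I_n -> F, (0 <= w x)%E ->
    (forall i, (0 <= w (f (c i)))%E) /\
    (w (f t) <= w (x - \sum_i f (c i) * z i)%R)%E.
  have [x_int|_] := boolP (0 <= w x)%E; last by exists (fun=> 0).
  by have [c cP] := z_approx x_int; exists c.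
move=> y_int.
pose rem := fix rem k := if k is k'.+1 then
  (rem k' - \sum_i f (C (rem k') i) * z i) / f t else y.
have rem_int k : (0 <= w (rem k))%E.
  elim: k => [|k IHk] //=; have [e we] := val_fin w ft0.
  by rewrite (val_ge_div _ _ ft0 we) add0r -we; case: (CP _ IHk).
pose s i k : F := \sum_(j < k) C (rem j) i * t ^+ j.
have sE k : y = \sum_i f (s i k) * z i + f t ^+ k * rem k.
  elim: k => [|k ->].
    by rewrite big1 ?add0r ?mul1r // => i _; rewrite /s big_ord0 rmorph0 mul0r.
  have remS : f t * rem k.+1 = rem k - \sum_i f (C (rem k) i) * z i.
    by rewrite /= mulrC divfK.
  rewrite [f t ^+ k.+1]exprSr -mulrA remS.
  under [in RHS]eq_bigr do rewrite /s big_ord_recr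
    rmorphD rmorphM rmorphXn mulrDl /= -/(s _ _).
  rewrite big_split /= mulrBr mulr_sumr -addrA; congr (_ + _).
  rewrite addrCA -[LHS]addr0; congr (_ + _); apply/esym/eqP.
  rewrite subr_eq0; apply/eqP/eq_bigr => i _.
  by rewrite mulrA [f t ^+ k * _]mulrC.
(* The partial sums differ by multiples of [t ^ k], and so do, in the limit,
   [s i k] and the coefficient [c i]. *)
have s_cauchy i k m : (k <= m)%N -> (k%:Z%:E <= w (f (s i m - s i k)%R))%E.
  move=> km; rewrite -(subnKC km) /s big_split_ord /= [_ + _ - _]addrAC subrr add0r.
  rewrite rmorph_sum val_ge_sum // => j.
  rewrite rmorphM rmorphXn -[k%:Z]add0r val_geM //.
    by case: (CP _ (rem_int (k + j))).
  by apply: le_trans (val_geXn _); rewrite lee_fin lez_nat leq_addr.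
have /boolp.choice[c cP] i : exists c, val_cvg (val_pull f w) (s i) c.
  apply: complete_F => g; exists `|g|.+1 => m k gm gk.
  rewrite /= -[s i m](subrK (s i `|g|.+1)) -addrA rmorphD.
  apply: (@lt_le_trans _ _ `|g|.+1%:Z%:E).
    by rewrite lte_fin -lezD1 intS addrC lerD2l abszE ler_norm.
  by rewrite val_geD ?s_cauchy // -opprB rmorphN valN s_cauchy.
have c_approx i k : (k%:Z%:E <= w (f (s i k - c i)%R))%E.
  have [N cN] := cP i k%:Z; pose m := maxn N k.
  rewrite -[s i k](subrK (s i m)) -addrA rmorphD val_geD //.
    by rewrite -opprB rmorphN valN s_cauchy ?leq_maxr.
  by apply: ltW; apply: cN; rewrite leq_maxl.
exists c; apply/eqP; rewrite -subr_eq0; apply/eqP/(val_unbounded_eq0 (v := w)) => k.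
rewrite {1}(sE k); rewrite addrAC -sumrB val_geD //.
  apply: val_ge_sum => i; rewrite -mulrBl -rmorphB -[k%:Z]addr0.
  by rewrite val_geM.
by rewrite -[k%:Z]addr0 val_geM ?val_geXn.
Qed.

Lemma approximated_finite_degree : finite_degree f.
Proof.
exists n, z => y; have [m ym] := val_lower w y.
have [|c cP] := @span_integral (f t ^+ absz m * y).
  apply: (@le_trans _ _ ((absz m)%:Z + m)%R%:E); last by rewrite val_geM ?val_geXn.
  by rewrite lee_fin addrC -lerBlDr sub0r lerNl abszE -normrN ler_norm.
exists (fun i => c i / t ^+ absz m).
have tm0 : f t ^+ absz m != 0 by rewrite expf_neq0 ?fmorph_eq0.
apply: (mulfI tm0); rewrite cP mulr_sumr; apply: eq_bigr => i _.
by rewrite fmorph_div rmorphXn mulrA mulrCA mulfV ?mulr1.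
Qed.

End SuccessiveApproximation.

(** * Residue fields *)

Lemma residue_sum (F : fieldType) (v : valuation F int) (I : finType) (s : I -> F) :
  (forall i, s i \in valring v) ->
  residue v (\sum_i s i) = \sum_i residue v (s i).
Proof.
move=> vs; rewrite -(big_enum _ _ _ s) -(big_enum _ _ _ (fun i => residue v (s i))) /=.
elim: (enum _) => [|i e IHe].
  by rewrite !big_nil; apply/eqP; rewrite residue_eq0 ?rpred0 // val0 ltry.
by rewrite !big_cons residueD ?IHe ?rpred_sum //; apply: vs.
Qed.

Section ResidueExtension.
Variables (F E : fieldType) (f : {rmorphism F -> E}).
Variables (v : valuation F int) (w : valuation E int).
Hypothesis fvw : forall x, (f x \in valring w) = (x \in valring v).

(** Lifts of generators of the residue extension approximate modulo the
    maximal ideal; dividing the error by a uniformizer [p] and approximating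
    again improves this to any power of that ideal. *)
Lemma residue_approx (p : E) : w p = 1%:E ->
  finite_degree (resmap f v w) ->
  forall m : nat, exists n (z : 'I_n -> E), (forall i, (0 <= w (z i))%E) /\
    forall y, (0 <= w y)%E -> exists c : 'I_n -> F,
      (forall i, (0 <= w (f (c i)))%E) /\
      (m%:Z%:E <= w (y - \sum_i f (c i) * z i)%R)%E.
Proof.
move=> wp [k [b bP]]; have p0 : p != 0 by apply/eqP => p0; move: wp; rewrite p0 val0.
pose B i := val (repr (b i)).
have B_int i : B i \in valring w := valP _.
elim=> [|m [n [z [z_int zP]]]].
  exists 0%N, (fun=> 0); split=> [[]|y y_int] //; exists (fun=> 0).
  by rewrite big_ord0 subr0; split=> // -[].
exists (k + n)%N, (fun i => match split i with inl j => B j | inr j => p * z j end).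
split=> [i|y y_int].
  case: (split i) => j; first exact: B_int.
  by rewrite valM adde_ge0 // wp.
have [c cP] := bP (residue w y); pose a i := val (repr (c i)).
have a_int i : f (a i) \in valring w by rewrite fvw; exact: valP (repr (c i)).
have aB_int i : f (a i) * B i \in valring w by rewrite rpredM ?a_int.
have S_int : \sum_i f (a i) * B i \in valring w by apply: rpred_sum => i _.
have y'_pos : (1%:E <= w (y - \sum_i f (a i) * B i)%R)%E.
  rewrite -[1]add0r -val_gtE -residue_eq0 ?rpredB //.
  rewrite residueB // residue_sum // cP subr_eq0; apply/eqP/eq_bigr => i _.
  by rewrite residueM // residue_repr.
have [|d [d_int dP]] := zP ((y - \sum_i f (a i) * B i) / p).
  by rewrite (val_ge_div _ _ p0 wp) add0r.
exists (fun i => match split i with inl j => a j | inr j => d j end).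
split=> [i|]; first by case: (split i).
rewrite big_split_ord /=.
under eq_bigr do rewrite (unsplitK (inl _)).
under [X in _ - (_ + X)]eq_bigr do rewrite (unsplitK (inr _)) mulrCA.
rewrite -mulr_sumr opprD addrA -[y - _](divfK p0) mulrC -mulrBr.
by rewrite -add1n PoszD val_geM ?wp.
Qed.

(** A relation of positive valuation between integral elements reduces to a
    relation between residues, which is nontrivial as one of its coefficients
    reduces to [1]. *)
Lemma resmap_dependent_finite_degree n :
  (forall g : 'I_n -> E, (forall i, g i \in valring w) ->
    exists c : 'I_n -> F, [/\ forall i, c i \in valring v,
      exists i, (0 < v (c i - 1)%R)%E &
      (0 < w (\sum_i f (c i) * g i)%R)%E]) ->
  finite_degree (resmap f v w).
Proof.
move=> dep.
pose h := resmap f v w.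
pose A := GRing.isZmodMorphism.Build _ _ h (resmap_zmod_morphism fvw).
pose M := GRing.isMonoidMorphism.Build _ _ h (resmap_monoid_morphism fvw).
pose H : {rmorphism resfield v -> resfield w} := HB.pack h A M.
apply: (@dependent_finite_degree _ _ H n) => b.
have [|c [c_int [i ci1] c_pos]] := dep (fun i => val (repr (b i))).
  by move=> i; exact: valP.
exists (fun i => residue v (c i)).
  exists i; rewrite -residue_eq0 ?rpredB ?rpred1 // residueB ?rpred1 // residue1 subr_eq0 in ci1.
  by rewrite (eqP ci1) oner_eq0.
have fc_int j : f (c j) \in valring w by rewrite fvw.
have b_int j : val (repr (b j)) \in valring w := valP _.
have cb_int j : f (c j) * val (repr (b j)) \in valring w by rewrite rpredM ?fc_int.
rewrite -residue_eq0 in c_pos; last by apply: rpred_sum => j _.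
rewrite -[RHS](eqP c_pos) residue_sum //.
apply: eq_bigr => j _.
by rewrite /= [h _](resmap_residue fvw) // residueM ?fc_int ?b_int // residue_repr.
Qed.

End ResidueExtension.

(** * The closure of a subfield *)

Section Closure.
Variables (F E : fieldType) (f : {rmorphism F -> E}) (u : valuation E int).

Definition closure : {pred E} :=
  fun y => boolp.asbool (val_closure u (fun z => exists a, z = f a) y).

Lemma closureP y :
  reflect (forall g : int, exists a, (g%:E < u (y - f a)%R)%E) (y \in closure).
Proof.
apply: (iffP (boolp.asboolP _)) => yP g; have := yP g.
  by case=> _ [a ->]; exists a.
by case=> a; exists (f a) => //; exists a.
Qed.

Lemma closure_image a : f a \in closure.
Proof. by apply/closureP => g; exists a; rewrite subrr val0 ltry. Qed.

Lemma closure_divring : divring_closed closure.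
Proof.
have mul y z : y \in closure -> z \in closure -> y * z \in closure.
  move=> /closureP yP /closureP zP; apply/closureP => g.
  have [m my] := val_lower u y; have [b zb] := zP (g - m).
  have [n nb] := val_lower u (f b); have [a ya] := yP (g - n).
  exists (a * b); rewrite rmorphM val_gtE.
  have -> : y * z - f a * f b = y * (z - f b) + (y - f a) * f b.
    by rewrite mulrBr mulrBl addrA subrK.
  rewrite val_gtE in zb; rewrite val_gtE in ya.
  rewrite val_geD //.
    by apply: le_trans (val_geM my zb); rewrite lee_fin addrA subrKC.
  by apply: le_trans (val_geM ya nb); rewrite lee_fin addrAC subrK.
(* If [a] is so close to [z] that both have valuation [m], then passing from
   [z - a] to [1 / z - 1 / a] lowers the valuation by [2 m] only. *)
have inv z : z \in closure -> z^-1 \in closure.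
  have [->|z0] := eqVneq z 0; first by rewrite invr0.
  move=> /closureP zP; apply/closureP => g; have [m zm] := val_fin u z0.
  have [a za] := zP (Num.max m (g + m + m)).
  have za1 : (m%:E < u (z - f a)%R)%E.
    by apply: le_lt_trans za; rewrite lee_fin le_max lexx.
  have {}za : ((g + m + m)%R%:E < u (z - f a)%R)%E.
    by apply: le_lt_trans za; rewrite lee_fin le_max lexx orbT.
  have am := val_fin_approx zm za1.
  have a0 : f a != 0 by apply/eqP => a0; move: am; rewrite a0 val0.
  exists a^-1; rewrite fmorphV -[X in X - _]mul1r -[X in _ - X]mul1r.
  rewrite -mulNr addf_div // mul1r mulN1r -valN -mulNr opprB val_gtE.
  have zam : u (z * f a) = (m + m)%:E by rewrite valM zm am.
  rewrite (val_ge_div _ _ _ zam) ?mulf_neq0 //.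
  by rewrite addrAC addrA -val_gtE.
split=> [|y z|y z].
- by rewrite -(rmorph1 f) closure_image.
- move=> /closureP yP /closureP zP; apply/closureP => g.
  have [a ya] := yP g; have [b zb] := zP g; exists (a - b).
  rewrite val_gtE rmorphB opprD addrACA -opprD val_geB //; last by rewrite -val_gtE.
  by rewrite -val_gtE.
by move=> yP zP; apply: mul => //; apply: inv.
Qed.
HB.instance Definition _ := GRing.isDivringClosed.Build E closure closure_divring.

(** The closure of [f(F)] in [E] is made a field in its own right so that
    matrices and polynomials can be formed over it. *)
Definition closure_field : Type := {y : E | y \in closure}.
HB.instance Definition _ := SubChoice.on closure_field.
HB.instance Definition _ := [SubChoice_isSubIntegralDomain of closure_field by <:].
HB.instance Definition _ := [SubIntegralDomain_isSubField of closure_field by <:].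

Definition closure_val : {rmorphism closure_field -> E} := val.

Definition to_closure (a : F) : closure_field := Sub (f a) (closure_image a).

Lemma to_closure_zmod_morphism : zmod_morphism to_closure.
Proof. by move=> a b; apply: val_inj; rewrite /= rmorphB. Qed.
HB.instance Definition _ :=
  GRing.isZmodMorphism.Build F closure_field to_closure to_closure_zmod_morphism.

Lemma to_closure_monoid_morphism : monoid_morphism to_closure.
Proof. by split=> [|a b]; apply: val_inj; rewrite /= ?rmorph1 ?rmorphM. Qed.
HB.instance Definition _ :=
  GRing.isMonoidMorphism.Build F closure_field to_closure to_closure_monoid_morphism.

Lemma to_closureK a : closure_val (to_closure a) = f a. Proof. by []. Qed.

Lemma val_complete_closure : val_complete u -> val_complete (val_pull closure_val u).
Proof.
move=> uC s s_cauchy; have [l sl] := uC (fun k => val (s k)) s_cauchy.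
have l_cl : l \in closure.
  apply/closureP => g; have [N sN] := sl g.
  have [a sa] := closureP _ (valP (s N)) g; exists a.
  rewrite -[l](subrK (val (s N))) -addrA val_gtE val_geD //.
    by rewrite -valN opprB -val_gtE sN.
  by rewrite -val_gtE.
by exists (Sub l l_cl) => g; have [N sN] := sl g; exists N => k /sN.
Qed.

End Closure.

(** * Rational functions *)

Section RationalFunction.
Variable K : fieldType.
Local Notation Kx := {fraction {poly K}}.

Lemma fractionP (phi : Kx) : exists p q : {poly K},
  q != 0 /\ phi = FracField.tofrac p / FracField.tofrac q.
Proof.
exists \n_(repr phi), \d_(repr phi); split; first exact: denom_ratioP.
have d0 : FracField.tofrac \d_(repr phi) != 0 by rewrite tofrac_eq0 denom_ratioP.
apply: (canRL (mulfK d0)); rewrite -{1}[phi]reprK; unlock FracField.tofrac.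
rewrite -[LHS]FracField.pi_mul; apply/eqmodP.
rewrite /= FracField.equivfE /FracField.mulf !numden_Ratio ?oner_neq0 //.
- by rewrite !mulr1 mulrC.
- by rewrite mulr1 denom_ratioP.
- by rewrite mulr1 denom_ratioP.
Qed.

Lemma common_denominator n (g : 'I_n -> Kx) : exists2 q : {poly K}, q != 0 &
  exists p : 'I_n -> {poly K}, forall i,
    g i * FracField.tofrac q = FracField.tofrac (p i).
Proof.
have /boolp.choice[r rP] i := fractionP (g i).
have /boolp.choice[s sP] := rP.
exists (\prod_i s i).
  by apply/prodf_neq0 => i _; case: (sP i).
exists (fun i => r i * \prod_(j | j != i) s j) => i; have [s0 gE] := sP i.
rewrite (bigD1 i) //= !tofracM {1}gE mulrA divfK //.
by rewrite tofrac_eq0.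
Qed.

Lemma horner_ratX (p : {poly K}) :
  (map_poly (@ratC K) p).[ratX K] = FracField.tofrac p.
Proof.
rewrite map_poly_comp horner_map -[RHS](congr1 _ (comp_polyXr p)) /comp_poly.
by rewrite (eq_map_poly (g := polyC)).
Qed.

Lemma ratX_transcendental : ~ algebraicOver (@ratC K) (ratX K).
Proof. by move=> [p p0]; rewrite rootE horner_ratX tofrac_eq0 (negPf p0). Qed.

(** Let [P] over [S] kill the image of [X]. After clearing a common
    denominator the rational functions become polynomials, whose remainders
    modulo [P] lie in a space of dimension less than the size of [P]. *)
Lemma ratfun_dependent (S L : fieldType) (h : {rmorphism S -> L})
    (iota : {rmorphism K -> S}) (f : {rmorphism Kx -> L}) :
  (forall a, h (iota a) = f (ratC a)) -> algebraicOver h (f (ratX K)) ->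
  exists n, forall g : 'I_n -> Kx, dependent h (fun i => f (g i)).
Proof.
move=> hf [P P0 Proot]; exists (size P) => g.
have [q q0 [p pE]] := common_denominator g.
pose rem i := map_poly iota (p i) %% P.
have remE i : (map_poly h (rem i)).[f (ratX K)] = f (g i * FracField.tofrac q).
  rewrite pE -horner_ratX.
  rewrite -horner_map -map_poly_comp -(eq_map_poly (f := h \o iota)) //.
  rewrite map_poly_comp (divp_eq (map_poly iota (p i)) P) rmorphD rmorphM.
  by rewrite hornerD hornerM (rootP Proot) mulr0 add0r.
pose d := (size P).-1.
pose M : 'M[S]_(size P, d) := \matrix_i poly_rV (rem i).
have : kermx M != 0.
  rewrite kermx_eq0 -row_leq_rank -ltnNge.
  by apply: leq_ltn_trans (rank_leq_col M) _; rewrite /d prednK // lt0n size_poly_eq0.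
move=> /rowV0Pn[c /sub_kermxP cM c0].
exists (fun i => c 0 i); first by apply/rV0Pn.
have : \sum_i c 0 i *: rem i = 0.
  have remE' i : rem i = rVpoly (row i M).
    rewrite rowK poly_rV_K // -ltnS prednK ?lt0n ?size_poly_eq0 //.
    by rewrite ltn_modp.
  under eq_bigr do rewrite remE' -linearZ.
  by rewrite -linear_sum -mulmx_sum_row cM linear0.
move=> sum0; have fq : f (FracField.tofrac q) != 0 by rewrite fmorph_eq0 tofrac_eq0.
apply: (mulIf fq); rewrite mul0r mulr_suml.
have := congr1 (fun s => (map_poly h s).[f (ratX K)]) sum0.
rewrite /= rmorph_sum rmorph0 horner0 horner_sum => sumL.
rewrite -[RHS]sumL; apply: eq_bigr => i _.
by rewrite /= map_polyZ hornerZ remE rmorphM mulrA.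
Qed.

End RationalFunction.

(** * Residue degree and algebraicity of the indeterminate *)

Section ResidueDegree.
Variables (K : fieldType) (v : valuation K int).
Variables (w : valuation {fraction {poly K}} int).
Hypotheses (discrete_v : discrete v) (discrete_w : discrete w).
Hypothesis ratC_vw : forall a : K, (ratC a \in valring w) = (a \in valring v).

(** The hypotheses of successive approximation hold over [K]; those over the
    closure of [K] in a completion follow by density. *)
Lemma ratfun_approx : finite_degree (resmap (@ratC K) v w) ->
  exists t : K, [/\ t != 0, (0 < w (ratC t))%E &
    exists n (z : 'I_n -> {fraction {poly K}}), (forall i, (0 <= w (z i))%E) /\
    forall y, (0 <= w y)%E -> exists c : 'I_n -> K,
      (forall i, (0 <= w (ratC (c i)))%E) /\
      (w (ratC t) <= w (y - \sum_i ratC (c i) * z i)%R)%E].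
Proof.
move=> fin; have [t vt] := discrete_v 1; have [p wp] := discrete_w 1.
have t0 : t != 0 by apply/eqP => t0; move: vt; rewrite t0 val0.
exists t; split=> //; first by rewrite (extension_gt0 ratC_vw) vt.
have [m wm] : exists m : int, w (ratC t) = m%:E.
  by apply: val_fin; rewrite fmorph_eq0.
have [n [z [z_int zP]]] := residue_approx ratC_vw wp fin (absz m).
exists n, z; split=> // y /zP[c [c_int cP]]; exists c; split=> //.
by apply: le_trans cP; rewrite wm lee_fin abszE ler_norm.
Qed.

(** Successive approximation expresses every element of [K(X)] exactly, with
    coefficients in the complete field [K]. *)
Lemma complete_residue_infinite :
  val_complete v -> ~ finite_degree (resmap (@ratC K) v w).
Proof.
move=> vC fin; have [t [t0 t_pos [n [z [z_int zP]]]]] := ratfun_approx fin.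
have vC' := val_complete_pull discrete_v ratC_vw vC.
apply: (@ratX_transcendental K).
apply: (finite_degree_algebraic (f := @ratC K)).
exact: (approximated_finite_degree vC' t0 t_pos z_int zP).
Qed.

Section Completion.
Variables (L : fieldType) (f : {rmorphism {fraction {poly K}} -> L}).
Variable u : valuation L int.
Hypothesis Lcompl : is_completion w f u.

Local Notation fK := (f \o @ratC K : {rmorphism K -> L}).
Local Notation Khat := (closure_field fK u).
Local Notation iota := (@closure_val _ _ fK u).

Lemma algebraic_over_closureP (x : L) :
  algebraic_over_subset (val_closure u (fun z => exists a, z = f (ratC a))) x
  <-> algebraicOver iota x.
Proof.
split=> [[p [p0 pA px]]|[p p0 px]]; last first.
  exists (map_poly iota p); split=> // [|i]; first by rewrite map_poly_eq0.
  rewrite coef_map; exact: (boolp.asboolW (valP p`_i)).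
have pcl i : p`_i \in closure fK u by apply/boolp.asboolP; exact: pA.
pose q : {poly Khat} := \poly_(i < size p) Sub p`_i (pcl i).
have qE : map_poly iota q = p.
  apply/polyP => i; rewrite coef_map coef_poly.
  by case: ltnP => [//|pi]; rewrite nth_default //.
exists q; last by rewrite qE.
by apply: contraNneq p0 => q0; rewrite -qE q0 rmorph0.
Qed.

Lemma finite_residue_algebraic :
  finite_degree (resmap (@ratC K) v w) -> forall x, algebraicOver iota x.
Proof.
case: Lcompl => uf dense uC fin.
have [t [t0 t_pos [n [z [z_int zP]]]]] := ratfun_approx fin.
pose j a : Khat := to_closure fK u a.
have ij a : iota (j a) = f (ratC a) by rewrite to_closureK.
apply: finite_degree_algebraic.
apply: (@approximated_finite_degree _ _ iota u (j t) n (fun i => f (z i))).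
- exact: val_complete_closure.
- by rewrite -(fmorph_eq0 iota) ij !fmorph_eq0.
- by rewrite ij uf.
- by move=> i; rewrite uf.
move=> y y_int; have [m wm] : exists m : int, w (ratC t) = m%:E.
  by apply: val_fin; rewrite fmorph_eq0.
have [_ [g ->] yg] := dense y m.
have ug : (0 <= u (f g))%E.
  apply: val_ge_approx y_int; apply: le_trans (ltW yg).
  by rewrite -wm ltW.
rewrite uf in ug; have [c [c_int cP]] := zP g ug.
exists (fun i => j (c i)); split=> [i|]; first by rewrite ij uf.
rewrite ij uf -(subrK (f g) y) -addrA val_geD //; first by rewrite wm ltW.
under eq_bigr do rewrite ij -rmorphM.
by rewrite -rmorph_sum -rmorphB uf.
Qed.

(** The relation over the closure given by [ratfun_dependent] is divided by its
    coefficient [c i1] of least valuation, and its coefficients are then moved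
    into [K] by an error of positive valuation. *)
Lemma algebraic_finite_residue :
  algebraicOver iota (f (ratX K)) -> finite_degree (resmap (@ratC K) v w).
Proof.
case: Lcompl => uf dense uC algX.
have ij a : iota (to_closure fK u a) = f (ratC a) by rewrite to_closureK.
have [n dep] := ratfun_dependent (iota := to_closure fK u) ij algX.
apply: (resmap_dependent_finite_degree (n := n) ratC_vw) => g g_int.
have [c [i0 ci0] sum0] := dep g.
pose val_c i := u (iota (c i)).
have [i1 _ minP] : extremum_spec <=%O xpredT val_c [arg min_(i < i0) val_c i]%O.
  exact: arg_minP.
have [m um] : exists m : int, val_c i1 = m%:E.
  have [m0 um0] : exists m : int, val_c i0 = m%:E by apply: val_fin; rewrite fmorph_eq0.
  apply: val_fin; apply/eqP => ci1; have := minP i0 isT.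
  by rewrite um0 /val_c ci1 val0.
have ci1 : iota (c i1) != 0 by apply/eqP => ci1; move: um; rewrite /val_c ci1 val0.
pose c' i := c i / c i1.
have /boolp.choice[a aP] i : exists a : K, (0 < u (iota (c' i) - f (ratC a))%R)%E.
  by have [a] := closureP _ _ _ (valP (c' i)) 0; exists a.
have c'_int i : (0 <= u (iota (c' i)))%E.
  by rewrite fmorph_div (val_ge_div _ _ ci1 um) add0r -um; exact: minP.
have a_int i : a i \in valring v.
  by rewrite -ratC_vw valringE -uf; apply: val_ge_approx (ltW (aP i)) _.
exists a; split=> //.
  exists i1; rewrite -(extension_gt0 ratC_vw) -uf 2!rmorphB.
  rewrite (rmorph1 (@ratC K)) (rmorph1 f) -valN opprB.
  by have := aP i1; rewrite /c' divff ?rmorph1 // -(fmorph_eq0 iota).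
have sum0' : \sum_i iota (c' i) * f (g i) = 0.
  rewrite -[RHS](mulr0 (iota (c i1))^-1) -[in RHS]sum0 mulr_sumr.
  by apply: eq_bigr => i _; rewrite fmorph_div mulrAC [LHS]mulrC.
rewrite -uf.
have -> : f (\sum_i ratC (a i) * g i) =
    \sum_i (f (ratC (a i)) - iota (c' i)) * f (g i).
  rewrite rmorph_sum -[LHS]subr0 -[X in _ - X]sum0' -sumrB.
  by apply: eq_bigr => i _; rewrite rmorphM mulrBl.
rewrite val_gtE val_ge_sum // => i; rewrite -[0 + 1]addr0 val_geM ?uf //; last exact: g_int.
by rewrite -val_gtE -valN opprB.
Qed.

End Completion.
End ResidueDegree.

(** A complete field equals its completion, so polynomials over the latter
    descend. *)
Lemma complete_algebraic (K Khat Kbar : fieldType) (i : {rmorphism K -> Khat})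
    (j : {rmorphism Khat -> Kbar}) (v : valuation K int) (vhat : valuation Khat int) :
  is_completion v i vhat -> val_complete v -> algebraic_ext j -> algebraic_ext (j \o i).
Proof.
move=> compl vC algj y; have /(val_completeP compl) /boolp.choice[s sP] := vC.
have [p p0 py] := algj y; pose q := \poly_(k < size p) s p`_k.
have qE : map_poly i q = p.
  apply/polyP => k; rewrite coef_map coef_poly.
  by case: ltnP => [_|pk]; [exact/esym/sP | rewrite nth_default //; exact: rmorph0].
exists q; last by rewrite map_poly_comp qE.
by apply: contraNneq p0 => q0; rewrite -qE q0 rmorph0.
Qed.

Theorem proposition4p8 (K : fieldType) (v : valuation K int)
    (w : valuation {fraction {poly K}} int) :
  discrete v -> perfect_field (resfield v) ->
  discrete w ->
  (forall a : K, (ratC a \in valring w) = (a \in valring v)) ->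
  algebraic_ext (resmap (@ratC K) v w) ->
  (forall (L : fieldType) (f : {rmorphism {fraction {poly K}} -> L})
      (u : valuation L int),
    is_completion w f u ->
    algebraic_over_subset
      (val_closure u (fun z => exists a : K, z = f (ratC a))) (f (ratX K))
    <-> finite_degree (resmap (@ratC K) v w))
  /\
  (val_complete v ->
    ~ finite_degree (resmap (@ratC K) v w)
    /\
    forall (Khat : fieldType) (i : {rmorphism K -> Khat})
      (vhat : valuation Khat int)
      (Kbar : fieldType) (j : {rmorphism Khat -> Kbar})
      (vbar : valuation Kbar rat)
      (C : fieldType) (l : {rmorphism Kbar -> C}) (vC : valuation C rat),
    is_completion v i vhat ->
    algebraic_closure j ->
    (forall x : Khat, vbar (j x) = er_map intr (vhat x)) ->
    is_completion vbar l vC ->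
    forall alpha : C,
    ~ algebraicOver (l \o j \o i) alpha ->
    valring w =i val_at (l \o j \o i) vC alpha ->
    ~ exists y : Kbar, alpha = l y).
Proof.
move=> discrete_v _ discrete_w ratC_vw _; split=> [L f u Lcompl|vC].
  rewrite algebraic_over_closureP; split.
    exact: algebraic_finite_residue.
  by move=> fin; exact: finite_residue_algebraic.
split; first exact: complete_residue_infinite.
move=> Khat i vhat Kbar j vbar C l vC' compl [algj _] _ _ alpha trans _ [y yE].
apply: trans; have [p p0 py] := complete_algebraic compl vC algj y.
exists p => //; rewrite yE -[map_poly _ p]/(map_poly (l \o (j \o i)) p).
by rewrite map_poly_comp /root horner_map fmorph_eq0.
Qed.
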